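(* Let $c=(1,1)$, let $\mathcal{P}_c$ be the set of all cylindric partitions with profile $c$, and let $F_c(z,q)=\sum_{\Lambda\in\mathcal{P}_c} z^{\max(\Lambda)}q^{|\Lambda|}$, so that the exponent of $z$ keeps track of the largest part of the cylindric partitions. Then $$F_c(z,q) = \frac{(-zq;q^2)_\infty}{(zq;q)_\infty}.$$
   Context: A partition is a finite (possibly empty) weakly decreasing sequence of positive integers $\lambda=(\lambda_1\ge\lambda_2\ge\cdots\ge\lambda_s)$; set $\lambda_j=0$ for $j>s$. For $c=(c_1,c_2)$ a pair of nonnegative integers, a cylindric partition with profile $c$ is a pair $\Lambda=(\lambda^{(1)},\lambda^{(2)})$ of partitions such that for all $j\ge 1$, $\lambda^{(1)}_j\ge \lambda^{(2)}_{j+c_2}$ and $\lambda^{(2)}_j\ge\lambda^{(1)}_{j+c_1}$. In particular, for $c=(1,1)$ the conditions are $\lambda^{(1)}_j\ge\lambda^{(2)}_{j+1}$ and $\lambda^{(2)}_j\ge\lambda^{(1)}_{j+1}$ for all $j\ge1$. The size $|\Lambda|$ is the sum of all the parts of $\lambda^{(1)}$ and $\lambda^{(2)}$, and $\max(\Lambda)$ is the largest part occurring in $\lambda^{(1)}$ or $\lambda^{(2)}$ (equal to $0$ for the empty cylindric partition). Notation: $(a;q)_\infty=\prod_{i\ge0}(1-aq^i)$, so $(-zq;q^2)_\infty=\prod_{i\ge 0}(1+zq^{2i+1})$. Identities are between formal power series in $z$ and $q$. *)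

(* Defs.v *)
From HB Require Import structures.
From mathcomp Require Import all_boot all_order all_algebra.
From mathcomp Require Import boolp classical_sets fsbigop.

Set Implicit Arguments.
Unset Strict Implicit.
Unset Printing Implicit Defensive.

Import GRing.Theory.
Local Open Scope classical_set_scope.
Local Open Scope ring_scope.

Record fps (R : Type) := FPS { fps_coef :> nat -> R }.

Lemma fpsP (R : Type) (f g : fps R) : (forall n, f n = g n) <-> f = g.
Proof.
by split=> [|-> //]; case: f; case: g => f g /= fg; congr FPS; apply: funext.
Qed.

HB.instance Definition _ (R : Type) := gen_eqMixin (fps R).
HB.instance Definition _ (R : Type) := gen_choiceMixin (fps R).

Section Ring.
Variable R : comNzRingType.
Implicit Types f g h : fps R.

Definition fps0 : fps R := FPS (fun=> 0).
Definition fps_opp f : fps R := FPS (fun n => - f n).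
Definition fps_add f g : fps R := FPS (fun n => f n + g n).

Fact fps_addA : associative fps_add.
Proof. by move=> f g h; apply/fpsP => n; apply: addrA. Qed.
Fact fps_addC : commutative fps_add.
Proof. by move=> f g; apply/fpsP => n; apply: addrC. Qed.
Fact fps_add0 : left_id fps0 fps_add.
Proof. by move=> f; apply/fpsP => n; apply: add0r. Qed.
Fact fps_addN : left_inverse fps0 fps_opp fps_add.
Proof. by move=> f; apply/fpsP => n; apply: addNr. Qed.

HB.instance Definition _ := GRing.isZmodule.Build (fps R)
  fps_addA fps_addC fps_add0 fps_addN.

Definition fps_const (a : R) : fps R := FPS (fun n => if n is 0%N then a else 0).
Definition fps_X : fps R := FPS (fun n => (n == 1%N)%:R).
Definition fps_mul f g : fps R :=
  FPS (fun n => \sum_(i < n.+1) f i * g (n - i)%N).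

(* The ring axioms are inherited from polynomials through truncation. *)
Definition fps_trunc N f : {poly R} := \poly_(i < N.+1) f i.

Lemma coef_fps_trunc N f n : (n <= N)%N -> (fps_trunc N f)`_n = f n.
Proof. by move=> le_nN; rewrite coef_poly ltnS le_nN. Qed.

Lemma coef_fps_truncM N f g n : (n <= N)%N ->
  (fps_trunc N f * fps_trunc N g)`_n = fps_mul f g n.
Proof.
move=> le_nN; rewrite coefM; apply: eq_bigr => i _.
rewrite !coef_fps_trunc ?(leq_trans (leq_subr _ _)) //.
by rewrite (leq_trans _ le_nN) // -ltnS.
Qed.

Fact fps_mulC : commutative fps_mul.
Proof.
by move=> f g; apply/fpsP => n; rewrite -!(@coef_fps_truncM n) // mulrC.
Qed.

Fact fps_mulA : associative fps_mul.
Proof.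
have mulE f g h n :
    fps_mul f (fps_mul g h) n = (fps_trunc n f * (fps_trunc n g * fps_trunc n h))`_n.
  rewrite coefM; apply: eq_bigr => i _.
  by rewrite coef_fps_trunc -1?ltnS // coef_fps_truncM ?leq_subr.
move=> f g h; apply/fpsP => n; rewrite [RHS](_ : _ = fps_mul h (fps_mul f g) n).
  by rewrite !mulE mulrA [in RHS]mulrC.
by rewrite fps_mulC.
Qed.

Fact fps_mul1 : left_id (fps_const 1) fps_mul.
Proof.
move=> f; apply/fpsP => n /=; rewrite big_ord_recl /= subn0 mul1r.
by rewrite big1 ?addr0 // => i _; rewrite mul0r.
Qed.

Fact fps_mulDl : left_distributive fps_mul +%R.
Proof.
move=> f g h; apply/fpsP => n /=; rewrite -big_split.
by apply: eq_bigr => i _; rewrite mulrDl.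
Qed.

Fact fps_1_neq0 : fps_const 1 != 0.
Proof. by apply/eqP => /fpsP/(_ 0%N)/eqP; rewrite oner_eq0. Qed.

HB.instance Definition _ := GRing.Zmodule_isComNzRing.Build (fps R)
  fps_mulA fps_mulC fps_mul1 fps_mulDl fps_1_neq0.

Definition fps_unit : pred (fps R) := fun f => `[< exists g, g * f = 1 >].
Definition fps_inv f : fps R := xget f [set g | g * f = 1].

Fact fps_mulVf : {in fps_unit, left_inverse 1 fps_inv *%R}.
Proof. by move=> f /asboolP/xgetPex; apply. Qed.
Fact fps_unitP f g : g * f = 1 -> fps_unit f.
Proof. by move=> gf1; apply/asboolP; exists g. Qed.
Fact fps_inv_out : {in [predC fps_unit], fps_inv =1 id}.
Proof.
by move=> f /asboolP nuf; apply: xgetPN => g gf1; apply: nuf; exists g.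
Qed.

HB.instance Definition _ := GRing.ComNzRing_hasMulInverse.Build (fps R)
  fps_mulVf fps_unitP fps_inv_out.

(* Convergence for the 'X-adic topology: each coefficient is eventually
   constant. Such a limit is unique; fps_lim is 0 for a divergent sequence. *)
Definition fps_cvg (u : nat -> fps R) (l : fps R) : Prop :=
  forall n, exists N, forall k, (N <= k)%N -> u k n = l n.

Definition fps_lim (u : nat -> fps R) : fps R := xget 0 [set l | fps_cvg u l].

(* Sum of a family in which each coefficient gets finitely many nonzero
   contributions (a coefficient with infinitely many of them is set to 0). *)
Definition fps_sum (T : choiceType) (A : set T) (F : T -> fps R) : fps R :=
  FPS (fun n => \sum_(i \in A) F i n).

Definition qpoch_inf (a q : fps R) : fps R :=
  fps_lim (fun N => \prod_(i < N) (1 - a * q ^+ i)).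

End Ring.

Arguments fps_X {R}.

(* Z[[z, q]] is represented as Z[[z]][[q]]. *)
Notation Zzq := (fps (fps int)).
Definition z : Zzq := fps_const fps_X.
Definition q : Zzq := fps_X.

Definition is_partition (s : seq nat) : bool := sorted geq s && all (ltn 0) s.

(* The j-th part, counted from j = 1; it is 0 when j > size s. *)
Definition part (s : seq nat) (j : nat) : nat := nth 0%N s j.-1.

Definition cylindric_partitions (c : nat * nat) : set (seq nat * seq nat) :=
  [set L | [/\ is_partition L.1, is_partition L.2 &
    forall j, (1 <= j)%N -> (part L.2 (j + c.2) <= part L.1 j)%N /\
                            (part L.1 (j + c.1) <= part L.2 j)%N]].

Definition cp_size (L : seq nat * seq nat) : nat := (sumn L.1 + sumn L.2)%N.

Definition cp_max (L : seq nat * seq nat) : nat := (\max_(x <- L.1 ++ L.2) x)%N.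

Definition cylindric_gf (c : nat * nat) : Zzq :=
  fps_sum (cylindric_partitions c) (fun L => z ^+ cp_max L * q ^+ cp_size L).

(* Main.v *)
Require Import Defs.
From mathcomp Require Import all_boot all_order all_algebra.
From mathcomp Require Import finmap boolp classical_sets functions.
From mathcomp Require Import cardinality fsbigop.
From mathcomp Require Import zify ring.

Set Implicit Arguments.
Unset Strict Implicit.
Unset Printing Implicit Defensive.

Import GRing.Theory.
Local Open Scope ring_scope.

(** Write [cyl_le a b] for the set of cylindric partitions of profile (1,1) whose
    two rows have at most a and at most b parts, [cyl_eq a b] for those with
    exactly a and b parts, and P(a,b), E(a,b) for their generating functions.

    When |a - b| <= 1 and a + b > 0, adding 1 to the first a entries of the
    first row and to the first b entries of the second, zeros included, is a
    bijection from [cyl_le a b] onto [cyl_eq a b] ([add_cols_image]).  It raises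
    the size by a + b and the largest part by 1, so that E(a,b) = z q^(a+b) P(a,b)
    ([gf_cyl_eq]).  On the other hand, the defining inequalities force the
    numbers of parts of the two rows to differ by at most 1 ([cyl_size]), which
    gives the disjoint decompositions
      P(k+1,k+1) = E(k+1,k+1) + E(k+1,k) + E(k,k+1) + P(k,k),
      P(k+1,k) = E(k+1,k) + P(k,k),  P(k,k+1) = E(k,k+1) + P(k,k).
    Eliminating P(k+1,k) and P(k,k+1) leaves
      (1 - z q^(2k+1)) (1 - z q^(2k+2)) P(k+1,k+1) = (1 + z q^(2k+1)) P(k,k)
    ([gf_cyl_le_rec]), hence by induction a finite form of the theorem
    ([gf_cyl_le_prod]): P(k,k) times the first 2k factors of (zq;q)_oo is the
    product of the first k factors of (-zq;q^2)_oo.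

    The theorem is the limit of this identity as k grows.  P(k,k) tends to the
    full generating function because a partition has at most as many parts as
    its size, the products tend to the q-Pochhammer symbols, and (zq;q)_oo is
    invertible because its constant term is 1. *)

(** * Convergence and infinite sums of formal power series *)

Section Fps.
Local Open Scope classical_set_scope.
Context {R : comNzRingType}.
Implicit Types (f g a b c : fps R) (u v : nat -> fps R).

Definition vanishes_below (n : nat) f : Prop := forall i, (i < n)%N -> f i = 0.

Lemma coefM_fps f g n : (f * g) n = \sum_(i < n.+1) f i * g (n - i)%N.
Proof. by []. Qed.

Lemma coefD_fps f g n : (f + g) n = f n + g n.
Proof. by []. Qed.

Lemma coefN_fps f n : (- f) n = - f n.
Proof. by []. Qed.

Lemma coef1_fps n : (1 : fps R) n = (n == 0%N)%:R.
Proof. by case: n. Qed.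

Lemma fps_coef0M f g : (f * g) 0%N = f 0%N * g 0%N.
Proof. by rewrite coefM_fps big_ord1. Qed.

Lemma vanishesM m n f g :
  vanishes_below m f -> vanishes_below n g -> vanishes_below (m + n) (f * g).
Proof.
move=> fm gn i lt_i; rewrite coefM_fps big1 // => j _.
have [lt_jm|le_mj] := ltnP j m; first by rewrite fm ?mul0r.
by rewrite gn ?mulr0 //; have := ltn_ord j; lia.
Qed.

Lemma vanishesMl n f g : vanishes_below n g -> vanishes_below n (f * g).
Proof. by move=> gn; apply: (@vanishesM 0). Qed.

Lemma vanishesX f n : f 0%N = 0 -> vanishes_below n (f ^+ n).
Proof.
move=> f0; elim: n => [//|n IH]; rewrite exprS.
by apply: (@vanishesM 1) => // -[].
Qed.

(** A coefficient of a product involves finitely many coefficients of the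
    factors, so a common threshold for these is what [fps_cvgM] needs. *)
Lemma fps_cvg_uniform u l n : fps_cvg u l ->
  exists N, forall k, (N <= k)%N -> forall i, (i <= n)%N -> u k i = l i.
Proof.
move=> ul; elim: n => [|n [N HN]].
  by have [N HN] := ul 0%N; exists N => k /HN ? [].
have [M HM] := ul n.+1; exists (maxn N M) => k.
rewrite geq_max => /andP[Nk Mk] i; rewrite leq_eqVlt => /predU1P[->|].
  exact: HM.
by rewrite ltnS; apply: HN.
Qed.

Lemma fps_cvgM u v l m :
  fps_cvg u l -> fps_cvg v m -> @fps_cvg R (fun k => u k * v k) (l * m).
Proof.
move=> ul vm n.
have [N HN] := fps_cvg_uniform n ul.
have [M HM] := fps_cvg_uniform n vm.
exists (maxn N M) => k; rewrite geq_max => /andP[Nk Mk].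
rewrite !coefM_fps; apply: eq_bigr => i _.
by rewrite HN ?HM ?leq_subr // -ltnS.
Qed.

Lemma fps_cvg_unique u l m : fps_cvg u l -> fps_cvg u m -> l = m.
Proof.
move=> ul um; apply/fpsP => n; have [N HN] := ul n; have [M HM] := um n.
by rewrite -(HN (maxn N M)) ?leq_maxl // HM ?leq_maxr.
Qed.

Lemma fps_lim_cvg u l : fps_cvg u l -> fps_cvg u (fps_lim u).
Proof. by move=> ul; apply: (@xgetPex _ 0 [set l | fps_cvg u l]); exists l. Qed.

Lemma fps_cvg_cst l : @fps_cvg R (fun=> l) l.
Proof. by move=> n; exists 0%N. Qed.

Lemma fps_cvg_subseq u l (s : nat -> nat) : (forall k, (k <= s k)%N) ->
  fps_cvg u l -> @fps_cvg R (fun k => u (s k)) l.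
Proof.
move=> s_ge ul n; have [N HN] := ul n; exists N => k Nk.
by apply: HN; apply: leq_trans (s_ge k).
Qed.

(** Completeness: coefficient n no longer changes once the index exceeds n, so
    the limit is read off on the diagonal. *)
Lemma fps_cvg_increments u :
  (forall k, vanishes_below k (u k.+1 - u k)) ->
  fps_cvg u (FPS (fun n => u n.+1 n)).
Proof.
move=> du n; exists n.+1 => k; elim: k => [//|k IH].
rewrite leq_eqVlt => /predU1P[[<-//]|]; rewrite ltnS => lt_nk.
rewrite -IH //; apply/eqP; rewrite -subr_eq0; apply/eqP.
exact: (du k n lt_nk).
Qed.

(** Multiplying by the factor of index k changes the product by a multiple of
    b^k, whose order is at least k. *)
Lemma qpoch_inf_cvg a b : b 0%N = 0 ->
  @fps_cvg R (fun N => \prod_(i < N) (1 - a * b ^+ i)) (qpoch_inf a b).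
Proof.
move=> b0; apply: fps_lim_cvg; apply: fps_cvg_increments => k.
rewrite big_ord_recr /= mulrBr mulr1 addrAC subrr add0r -mulrN -mulNr.
by do 2!apply: vanishesMl; apply: vanishesX.
Qed.

(** The inverse is the geometric series in h = 1 - f, which converges because h
    has no constant term. *)
Lemma fps_unit_coef0 f : f 0%N = 1 -> f \is a GRing.unit.
Proof.
move=> f0; pose h := 1 - f.
have h0 : h 0%N = 0 by rewrite coefD_fps coefN_fps coef1_fps f0 subrr.
pose u N := \sum_(i < N) h ^+ i.
have /fps_lim_cvg ul : fps_cvg u (FPS (fun n => u n.+1 n)).
  apply: fps_cvg_increments => k.
  by rewrite /u big_ord_recr /= addrAC subrr add0r; apply: vanishesX.
apply/unitrPr; exists (fps_lim u).
apply: (@fps_cvg_unique (fun k : nat => f * u k)).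
  exact: (fps_cvgM (fps_cvg_cst f) ul).
move=> n; exists n.+1 => k lt_nk.
have -> : f * u k = 1 - h ^+ k.
  by rewrite -opprB subrX1 -mulNr opprB subKr.
by rewrite coefD_fps coefN_fps vanishesX // oppr0 addr0.
Qed.

Lemma qpoch_inf_unit a b : a 0%N = 0 -> b 0%N = 0 ->
  qpoch_inf a b \is a GRing.unit.
Proof.
move=> a0 b0; apply: fps_unit_coef0.
have [N HN] := qpoch_inf_cvg a b0 0%N; rewrite -(HN N) //.
elim: {HN} N => [|N IH]; first by rewrite big_ord0.
rewrite big_ord_recr fps_coef0M IH mul1r coefD_fps coefN_fps fps_coef0M a0.
by rewrite mul0r subr0.
Qed.

(** The condition under which no coefficient of [fps_sum A F] is reset to 0 for
    having infinitely many contributions. *)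
Definition fps_summable (T : choiceType) (A : set T) (F : T -> fps R) : Prop :=
  forall n, finite_set (A `&` [set i | F i n != 0]).

(** For the coefficients up to n, a summable family can be replaced by a finite
    one. *)
Lemma fps_sum_seq (T : choiceType) (A : set T) (F : T -> fps R) n :
  fps_summable A F -> exists r : seq T, [/\ uniq r, {in r, forall i, A i} &
    forall k, (k <= n)%N -> forall i, A i -> i \notin r -> F i k = 0].
Proof.
move=> AF.
have fin : finite_set (\bigcup_(k in `I_n.+1) (A `&` [set i | F i k != 0])).
  by apply: bigcup_finite => //; apply: finite_II.
exists (fset_set (\bigcup_(k in `I_n.+1) (A `&` [set i | F i k != 0]))).
split=> [|i|k le_kn i Ai].
- exact: fset_uniq.
- by rewrite in_fset_set // inE => -[k _ []].
- rewrite in_fset_set //; apply: contraNeq => Fik; rewrite inE.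
  by exists k => //=; rewrite ltnS.
Qed.

Lemma fps_sum_mulr (T : choiceType) (A : set T) (F : T -> fps R) c :
  fps_summable A F -> fps_sum A (fun i => c * F i) = c * fps_sum A F.
Proof.
move=> AF; apply/fpsP => n; have [r [r_uniq rA Fr]] := fps_sum_seq n AF.
have sumE G : (forall i, A i -> i \notin r -> G i = 0) ->
    \sum_(i \in A) G i = \sum_(i <- r) G i :> R.
  move=> Gr; rewrite (fsbigE r) //.
  by rewrite big_seq_cond [RHS]big_seq; apply: eq_bigl => i;
     case: (boolP (i \in r)) => //= /rA Ai; rewrite mem_set.
rewrite [LHS]sumE => [|i Ai ir]; last first.
  by rewrite coefM_fps big1 // => j _; rewrite Fr ?mulr0 ?leq_subr.
rewrite coefM_fps; under [RHS]eq_bigr => j _.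
  rewrite /= sumE; last by move=> i Ai; apply: Fr; rewrite ?leq_subr.
  rewrite big_distrr /=; over.
by rewrite exchange_big.
Qed.

Lemma fps_sumU (T : choiceType) (A B : set T) (F : T -> fps R) :
  fps_summable A F -> fps_summable B F -> A `&` B `<=` set0 ->
  fps_sum (A `|` B) F = fps_sum A F + fps_sum B F.
Proof.
move=> AF BF AB; apply/fpsP => n; rewrite coefD_fps /=.
have suppE D : \sum_(i \in D) F i n
             = \sum_(i \in D `&` [set i | F i n != 0]) F i n.
  apply: esym; apply: fsbig_widen => [i []//|i [Di /=]].
  by case: eqVneq => // Fi /not_andP[].
rewrite suppE setIUl fsbigU0 -?suppE //.
by move=> i [[Ai _] [Bi _]]; apply: (AB i).
Qed.

Lemma fps_sum_image (S T : choiceType) (A : set S) (h : S -> T)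
    (F : T -> fps R) : set_inj A h ->
  fps_sum (h @` A) F = fps_sum A (F \o h).
Proof. by move=> h_inj; apply/fpsP => n /=; apply: fsbig_image. Qed.

Lemma eq_fps_sum (T : choiceType) (A : set T) (F G : T -> fps R) :
  {in A, F =1 G} -> fps_sum A F = fps_sum A G.
Proof.
by move=> FG; apply/fpsP => n /=; apply: eq_fsbigr => i Ai; rewrite FG.
Qed.

End Fps.

(** * Adding and deleting a column of a partition *)

Section Partitions.
Local Open Scope nat_scope.
Implicit Types (s t : seq nat) (L : seq nat * seq nat).

Lemma partition_nth_le s i j : is_partition s -> i <= j ->
  nth 0 s j <= nth 0 s i.
Proof.
case/andP=> s_sorted _ le_ij; have [lt_js|le_sj] := ltnP j (size s).
  have geq_trans : transitive geq by move=> y x w yx wy; apply: leq_trans yx.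
  have nth_le := sorted_leq_nth geq_trans leqnn 0 s_sorted.
  by apply: nth_le; rewrite ?inE // (leq_ltn_trans le_ij).
by rewrite nth_default.
Qed.

Lemma partition_nth_gt0 s i : is_partition s -> (0 < nth 0 s i) = (i < size s).
Proof.
case/andP=> _ /allP s_gt0; have [lt_is|le_si] := ltnP i (size s).
  exact/s_gt0/mem_nth.
by rewrite nth_default.
Qed.

(** The parts being positive, the length is determined by the sequence padded
    with zeros. *)
Lemma partition_ext s t : is_partition s -> is_partition t ->
  nth 0 s =1 nth 0 t -> s = t.
Proof.
move=> ps pt st; apply: (@eq_from_nth _ 0) => [|i _]; last exact: st.
have lt_size i : (i < size s) = (i < size t).
  by rewrite -!partition_nth_gt0 // st.
apply/eqP; rewrite eqn_leq; apply/andP; split; rewrite leqNgt.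
  by rewrite lt_size ltnn.
by rewrite -lt_size ltnn.
Qed.

Lemma max_partition s : is_partition s -> \max_(x <- s) x = nth 0 s 0.
Proof.
elim: s => [|x s IH] ps; first by rewrite big_nil.
have le_x := @partition_nth_le _ 0 1 ps isT.
have {}ps : is_partition s.
  by case/andP: ps => /path_sorted ? /andP[_ ?]; apply/andP.
by rewrite big_cons IH //=; apply/maxn_idPl.
Qed.

Lemma size_le_sumn s : is_partition s -> size s <= sumn s.
Proof. by case/andP=> _; elim: s => //= x s IH /andP[x0 /IH]; lia. Qed.

Lemma sumn_nth s k : size s <= k -> sumn s = \sum_(i < k) nth 0 s i.
Proof.
elim: s k => [|x s IH] [|k] //= le_sk; rewrite ?big_ord0 //.
  by rewrite big1 // => i _; rewrite nth_nil.
by rewrite big_ord_recl /= (IH k).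
Qed.

(** Entries of s past the end count as zeros and become parts equal to 1: when s
    has at most k parts, this is its Young diagram with a new first column of
    height k. *)
Definition add_col k s := mkseq (fun i => (nth 0 s i).+1) k.

(** The parts equal to 1 would become zeros, so they are dropped. *)
Definition del_col s := [seq x.-1 | x <- s & 1 < x].

Lemma nth_add_col k s i :
  nth 0 (add_col k s) i = if i < k then (nth 0 s i).+1 else 0.
Proof.
rewrite /add_col; case: ltnP => le_ik; first by rewrite nth_mkseq.
by rewrite nth_default ?size_mkseq.
Qed.

Lemma nth_del_col s i : is_partition s -> nth 0 (del_col s) i = (nth 0 s i).-1.
Proof.
elim: s i => [|x s IH] i ps; first by rewrite !nth_nil.
have le_x j := @partition_nth_le _ 0 j ps isT.
have {}ps : is_partition s.
  by case/andP: ps => /path_sorted ? /andP[_ ?]; apply/andP.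
rewrite /del_col /=; case: ltnP => [_|x1]; first by case: i => //= i; apply: IH.
(* The first part is at most 1, hence so are all the others. *)
by rewrite -/(del_col s) IH //; have := le_x i; have := le_x i.+1; rewrite /=; lia.
Qed.

Lemma partition_add_col k s : is_partition s -> is_partition (add_col k s).
Proof.
move=> ps; apply/andP; split; last by rewrite all_map; apply/allP.
apply/(sortedP 0) => i _; rewrite /geq /= !nth_add_col.
have := @partition_nth_le s i i.+1 ps (leqnSn i).
by case: (ltnP i k) => ?; case: (ltnP i.+1 k) => ?; lia.
Qed.

Lemma partition_del_col s : is_partition s -> is_partition (del_col s).
Proof.
move=> ps; apply/andP; split.
  apply/(sortedP 0) => i _; rewrite /geq /= !nth_del_col //.
  have := @partition_nth_le s i i.+1 ps (leqnSn i); lia.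
by rewrite all_map all_filter; apply/allP => x _ /=; apply/implyP; lia.
Qed.

Lemma add_colK k s : is_partition s -> size s <= k ->
  del_col (add_col k s) = s.
Proof.
move=> ps le_sk; have pa := partition_add_col k ps.
apply: partition_ext => // [|i]; first exact: partition_del_col.
rewrite nth_del_col // nth_add_col; case: ltnP => // le_ki.
by rewrite nth_default // (leq_trans le_sk).
Qed.

Lemma del_colK s : is_partition s -> add_col (size s) (del_col s) = s.
Proof.
move=> ps; have pd := partition_del_col ps.
apply: partition_ext => // [|i]; first exact: partition_add_col.
rewrite nth_add_col nth_del_col // -partition_nth_gt0 //.
by case: (nth 0 s i).
Qed.

Lemma size_del_col s : size (del_col s) <= size s.
Proof. by rewrite size_map size_filter count_size. Qed.

Lemma sumn_add_col k s : size s <= k -> sumn (add_col k s) = sumn s + k.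
Proof.
move=> le_sk; rewrite (sumn_nth le_sk) (@sumn_nth _ k) ?size_mkseq //.
under eq_bigr => i _ do rewrite nth_add_col ltn_ord -addn1.
by rewrite big_split /= sum1_card card_ord.
Qed.

End Partitions.

(** * Cylindric partitions of profile (1,1) by number of parts *)

Local Notation cyl := (cylindric_partitions (1%N, 1%N)).

Section CylindricPartitions.
Local Open Scope nat_scope.
Local Open Scope classical_set_scope.
Implicit Types (s t : seq nat) (L : seq nat * seq nat).

Lemma cylP L : cyl L <-> [/\ is_partition L.1, is_partition L.2 &
  forall i, nth 0 L.2 i.+1 <= nth 0 L.1 i /\ nth 0 L.1 i.+1 <= nth 0 L.2 i].
Proof.
split=> -[p1 p2 H]; split=> //.
  by move=> i; have := H i.+1 isT; rewrite /part /= !addn1.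
by case=> // i _; have := H i; rewrite /part /= !addn1.
Qed.

(** The last part of one row is positive, so the entry just before that position
    in the other row is positive as well. *)
Lemma cyl_size L : cyl L -> size L.1 <= (size L.2).+1 /\ size L.2 <= (size L.1).+1.
Proof.
have aux s t : is_partition s -> is_partition t ->
    (forall i, nth 0 s i.+1 <= nth 0 t i) -> size s <= (size t).+1.
  move=> ps pt st; rewrite leqNgt -partition_nth_gt0 //.
  by apply/negP => /leq_trans /(_ (st _)); rewrite partition_nth_gt0 ?ltnn.
case/cylP=> p1 p2 H; split; apply: aux => // i; by have [] := H i.
Qed.

Definition cyl_le a b : set (seq nat * seq nat) :=
  [set L | [/\ cyl L, size L.1 <= a & size L.2 <= b]].

Definition cyl_eq a b : set (seq nat * seq nat) :=
  [set L | [/\ cyl L, size L.1 = a & size L.2 = b]].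

Definition add_cols a b L := (add_col a L.1, add_col b L.2).

(** A nonzero entry at position i+1 of one row requires a nonzero entry at
    position i of the other: this holds in the image because a and b differ by at
    most 1, and every other inequality is shifted by 1 on both sides. *)
Lemma add_cols_image a b : a <= b.+1 -> b <= a.+1 ->
  add_cols a b @` cyl_le a b = cyl_eq a b.
Proof.
move=> ab ba; apply/seteqP; split=> [_ [L [/cylP[p1 p2 H] s1 s2] <-]|L].
  split; rewrite ?size_mkseq //; apply/cylP.
  split=> [||i]; rewrite ?partition_add_col //= !nth_add_col.
  have [H1 H2] := H i.
  split; first by case: (ltnP i.+1 b) => ?; case: (ltnP i a) => ?; lia.
  by case: (ltnP i.+1 a) => ?; case: (ltnP i b) => ?; lia.
move=> [/cylP[p1 p2 H] <- <-]; exists (del_col L.1, del_col L.2); last first.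
  by rewrite /add_cols /= !del_colK // -surjective_pairing.
split; rewrite ?size_del_col //; apply/cylP.
split=> [||i]; rewrite ?partition_del_col //= !nth_del_col //.
by have := H i; lia.
Qed.

Lemma add_cols_inj a b : set_inj (cyl_le a b) (add_cols a b).
Proof.
have K L : cyl_le a b L ->
    (del_col (add_cols a b L).1, del_col (add_cols a b L).2) = L.
  by case=> /cylP[p1 p2 _] s1 s2; rewrite !add_colK // -surjective_pairing.
by move=> L M /set_mem/K LK /set_mem/K MK LM; rewrite -LK -MK LM.
Qed.

Lemma cp_max_cyl L : cyl L -> cp_max L = maxn (nth 0 L.1 0) (nth 0 L.2 0).
Proof. by case/cylP=> p1 p2 _; rewrite /cp_max big_cat /= !max_partition. Qed.

Lemma cp_max_add_cols a b L : a <= b.+1 -> b <= a.+1 -> 0 < a + b ->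
  cyl_le a b L -> cp_max (add_cols a b L) = (cp_max L).+1.
Proof.
move=> ab ba ab0 cL.
have [cA _ _] : cyl_eq a b (add_cols a b L) by rewrite -add_cols_image //; exists L.
case: cL => cL s1 s2; rewrite !cp_max_cyl // !nth_add_col.
have s0 s k : size s <= k -> k = 0 -> nth 0 s 0 = 0.
  by move=> + k0; rewrite k0; case: s.
have := s0 _ _ s1; have := s0 _ _ s2.
by case: (posnP a) => ?; case: (posnP b) => ?; lia.
Qed.

Lemma cp_size_add_cols a b L : cyl_le a b L ->
  cp_size (add_cols a b L) = cp_size L + (a + b).
Proof. by case=> _ s1 s2; rewrite /cp_size /= !sumn_add_col // addnACA. Qed.

Lemma cyl_le_split k : cyl_le k.+1 k.+1 =
  cyl_eq k.+1 k.+1 `|` (cyl_eq k.+1 k `|` (cyl_eq k k.+1 `|` cyl_le k k)).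
Proof.
apply/seteqP; split=> L.
  case=> cL s1 s2; have [s12 s21] := cyl_size cL.
  have [e1|n1] := eqVneq (size L.1) k.+1; have [e2|n2] := eqVneq (size L.2) k.+1.
  - by left.
  - by right; left; split=> //; lia.
  - by right; right; left; split=> //; lia.
  - by right; right; right; split=> //; lia.
by case=> [|[|[|]]] [cL s1 s2]; split=> //; lia.
Qed.

Lemma cyl_le_splitl k : cyl_le k.+1 k = cyl_eq k.+1 k `|` cyl_le k k.
Proof.
apply/seteqP; split=> L.
  case=> cL s1 s2; have [s12 s21] := cyl_size cL.
  have [e1|n1] := eqVneq (size L.1) k.+1; first by left; split=> //; lia.
  by right; split=> //; lia.
by case=> -[cL s1 s2]; split=> //; lia.
Qed.

Lemma cyl_le_splitr k : cyl_le k k.+1 = cyl_eq k k.+1 `|` cyl_le k k.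
Proof.
apply/seteqP; split=> L.
  case=> cL s1 s2; have [s12 s21] := cyl_size cL.
  have [e2|n2] := eqVneq (size L.2) k.+1; first by left; split=> //; lia.
  by right; split=> //; lia.
by case=> -[cL s1 s2]; split=> //; lia.
Qed.

Lemma finite_bounded_seqs n m :
  finite_set [set s | size s <= n /\ all (fun x => x <= m) s].
Proof.
elim: n => [|n IH].
  by apply: sub_finite_set (finite_set1 [::]) => s /= []; case: s.
have fin : finite_set ([set [::]] `|` [set x :: s | x in `I_m.+1
    & s in [set s | size s <= n /\ all (fun x => x <= m) s]]).
  rewrite finite_setU; split; first exact: finite_set1.
  by apply: finite_image2 => //; apply: finite_II.
apply: sub_finite_set fin => -[|x s] [/= ss]; first by left.
by case/andP=> xm sm; right; exists x => //; exists s.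
Qed.

(** A partition of size at most n has at most n parts, each at most n. *)
Lemma finite_cyl n : finite_set [set L | cyl L /\ cp_size L <= n].
Proof.
pose S := [set s | size s <= n /\ all (fun x => x <= n) s].
have fin : finite_set (S `*` S) by apply: finite_setX; apply: finite_bounded_seqs.
have SP s : is_partition s -> sumn s <= n -> S s.
  move=> ps sn; split; first exact: leq_trans (size_le_sumn ps) sn.
  apply/allP => x xs; apply: leq_trans sn.
  by rewrite sumnE (big_rem x) //= leq_addr.
apply: sub_finite_set fin => L [/cylP[p1 p2 _]]; rewrite /cp_size => Ln.
by split; apply: SP => //; lia.
Qed.

End CylindricPartitions.

(** * Recurrence for the generating functions *)

Section GeneratingFunctions.
Local Open Scope classical_set_scope.

Definition weight (L : seq nat * seq nat) : Zzq := z ^+ cp_max L * q ^+ cp_size L.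

Definition gf (A : set (seq nat * seq nat)) : Zzq := fps_sum A weight.

Lemma coef0_q : q 0%N = 0. Proof. by []. Qed.

Lemma weight_vanishes L : vanishes_below (cp_size L) (weight L).
Proof. by apply: vanishesMl; apply: vanishesX coef0_q. Qed.

Lemma summable_weight A : A `<=` cyl -> fps_summable A weight.
Proof.
move=> Acyl n; apply: sub_finite_set (finite_cyl n) => L [/Acyl cL /eqP wL].
by split=> //; rewrite leqNgt; apply/negP => /weight_vanishes.
Qed.

Lemma cyl_le_sub a b : cyl_le a b `<=` cyl.
Proof. by move=> L []. Qed.

Lemma gf_cyl_eq a b : (a <= b.+1)%N -> (b <= a.+1)%N -> (0 < a + b)%N ->
  gf (cyl_eq a b) = z * q ^+ (a + b) * gf (cyl_le a b).
Proof.
move=> ab ba ab0; rewrite -add_cols_image // /gf fps_sum_image; last first.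
  exact: add_cols_inj.
rewrite -fps_sum_mulr; last exact/summable_weight/cyl_le_sub.
apply: eq_fps_sum => L /set_mem cL.
rewrite /weight /= cp_max_add_cols // cp_size_add_cols // exprS exprD.
ring.
Qed.

Lemma gfU A B : A `<=` cyl -> B `<=` cyl -> (A `&` B `<=` set0) ->
  gf (A `|` B) = gf A + gf B.
Proof. by move=> Ac Bc; apply: fps_sumU; apply: summable_weight. Qed.

(** The linear system given by the three decompositions, with Pl and Pr the series
    for the two unbalanced shapes (k+1,k) and (k,k+1). *)
Lemma unbalanced_elimination (S : comPzRingType) (x y P Pl Pr P0 : S) :
  Pl = x * Pl + P0 -> Pr = x * Pr + P0 ->
  P = y * P + (x * Pl + (x * Pr + P0)) ->
  P * (1 - x) * (1 - y) = (1 + x) * P0.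
Proof.
move=> El Er E.
have -> : P * (1 - x) * (1 - y) = (P - y * P) * (1 - x) by ring.
rewrite {1}E [_ - y * P]addrAC subrr add0r.
have -> : (x * Pl + (x * Pr + P0)) * (1 - x) =
    x * (Pl - x * Pl) + x * (Pr - x * Pr) + P0 * (1 - x) by ring.
rewrite {1}El {1}Er ![x * _ + P0 - _]addrAC !subrr.
ring.
Qed.

Lemma gf_cyl_le_rec k :
  gf (cyl_le k.+1 k.+1) * (1 - z * q ^+ k.*2.+1) * (1 - z * q ^+ k.*2.+2) =
  (1 + z * q ^+ k.*2.+1) * gf (cyl_le k k).
Proof.
have disj a b c d : (c < a)%N || (d < b)%N -> 
    cyl_eq a b `&` cyl_le c d `<=` set0.
  by move=> abcd L [[_ sa sb] [_ sc sd]]; move: abcd; rewrite -sa -sb; lia.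
have Gl : gf (cyl_le k.+1 k) =
    z * q ^+ k.*2.+1 * gf (cyl_le k.+1 k) + gf (cyl_le k k).
  rewrite {1}cyl_le_splitl gfU ?gf_cyl_eq; try by [lia | move=> L []].
  - by rewrite addSn addnn.
  - by apply: disj; rewrite ltnSn.
have Gr : gf (cyl_le k k.+1) =
    z * q ^+ k.*2.+1 * gf (cyl_le k k.+1) + gf (cyl_le k k).
  rewrite {1}cyl_le_splitr gfU ?gf_cyl_eq; try by [lia | move=> L []].
  - by rewrite addnS addnn.
  - by apply: disj; rewrite ltnSn orbT.
have G : gf (cyl_le k.+1 k.+1) = z * q ^+ k.*2.+2 * gf (cyl_le k.+1 k.+1)
    + (z * q ^+ k.*2.+1 * gf (cyl_le k.+1 k)
    + (z * q ^+ k.*2.+1 * gf (cyl_le k k.+1) + gf (cyl_le k k))).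
  rewrite {1}cyl_le_split gfU; first last.
  - by move=> L [[_ a1 a2] [|[|]] [_]]; lia.
  - by move=> L [|[|]] [].
  - by move=> L [].
  rewrite gfU; first last.
  - by move=> L [[_ a1 a2] [|] [_]]; lia.
  - by move=> L [|] [].
  - by move=> L [].
  rewrite gfU; first last.
  - by apply: disj; rewrite ltnSn orbT.
  - by move=> L [].
  - by move=> L [].
  by rewrite !gf_cyl_eq ?addSn ?addnS ?addnn; try lia.
exact: unbalanced_elimination Gl Gr G.
Qed.

Lemma gf_cyl_le0 : gf (cyl_le 0 0) = 1.
Proof.
have -> : cyl_le 0 0 = [set ([::], [::])].
  apply/seteqP; split=> [[[|? ?] [|? ?]] [] //|_ ->].
  by split=> //; apply/cylP; split=> // i; rewrite nth_nil.
apply/fpsP => n; rewrite [LHS]fsbig_set1.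
by rewrite /weight /cp_max big_nil mulr1.
Qed.

Lemma prod_telescope (S : comPzRingType) (P a b : nat -> S) : P 0%N = 1 ->
  (forall k, P k.+1 * (a k.*2 * a k.*2.+1) = b k * P k) ->
  forall k, P k * \prod_(i < k.*2) a i = \prod_(i < k) b i.
Proof.
move=> P0 PS; elim=> [|k IH]; first by rewrite !big_ord0 P0 mulr1.
rewrite doubleS !big_ord_recr /= -IH -mulrA mulrCA PS.
by rewrite mulrCA mulrC [P k * _]mulrC.
Qed.

Lemma gf_cyl_le_prod k :
  gf (cyl_le k k) * \prod_(i < k.*2) (1 - z * q * q ^+ i) =
  \prod_(i < k) (1 - - z * q * (q ^+ 2) ^+ i).
Proof.
apply: (@prod_telescope _ (fun k => gf (cyl_le k k))
  (fun i => 1 - z * q * q ^+ i) (fun i => 1 - - z * q * (q ^+ 2) ^+ i)).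
  exact: gf_cyl_le0.
have qE i : z * q * q ^+ i = z * q ^+ i.+1 by rewrite exprS mulrA.
have q2E i : - z * q * (q ^+ 2) ^+ i = - (z * q ^+ i.*2.+1).
  by rewrite -exprM mul2n !mulNr qE.
move=> {}k; cbv beta; rewrite mulrA !qE q2E opprK.
exact: gf_cyl_le_rec.
Qed.

(** A cylindric partition outside [cyl_le k k] has size greater than k, so it does
    not contribute to the coefficients up to k. *)
Lemma gf_cyl_le_cvg : fps_cvg (fun k => gf (cyl_le k k)) (gf cyl).
Proof.
move=> n; exists n => k le_nk /=; apply: fsbig_widen; first exact: cyl_le_sub.
move=> L [cL nL] /=; apply: weight_vanishes.
have [p1 p2 _] := (cylP L).1 cL.
rewrite ltnNge; apply/negP => Ln; apply: nL; have Lk := leq_trans Ln le_nk.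
split=> //; apply: leq_trans (size_le_sumn _) _ => //; apply: leq_trans Lk.
  exact: leq_addr.
exact: leq_addl.
Qed.

End GeneratingFunctions.

Theorem theorem6 :
  cylindric_gf (1%N, 1%N) =
  qpoch_inf (- z * q) (q ^+ 2) / qpoch_inf (z * q) q.
Proof.
have zq0 : (z * q) 0%N = 0 by rewrite fps_coef0M mulr0.
apply: (canRL (mulrK (qpoch_inf_unit zq0 coef0_q))).
apply: (@fps_cvg_unique _ (fun k => \prod_(i < k) (1 - - z * q * (q ^+ 2) ^+ i))).
  have := qpoch_inf_cvg (z * q) coef0_q.
  move/(fps_cvg_subseq (s := double)) => /(_ (fun k => ltac:(lia))) Dcvg.
  have := fps_cvgM gf_cyl_le_cvg Dcvg.
  by rewrite (funext gf_cyl_le_prod).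
by apply: qpoch_inf_cvg; rewrite expr2 fps_coef0M mulr0.
Qed.
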